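(* Let $f:C\to\mathbb{R}$ be convex and differentiable on a closed convex set $C\subseteq\mathbb{R}^{n}$, with $f^{\min}=\min_{x\in C}f(x)$, and let $f_\ell:\mathbb{R}^{n_\ell}\to(-\infty,\infty]$, $\ell=1,\dots,\mathcal{L}$, be convex coarse functions. Assume: (A) $f$ is $L$-smooth relative to $\varphi$ on $C$ for some $L>0$, and for every $x\in\operatorname{int}C$, $\tau>0$ the problem $\min_{u\in C}\{\tau\langle\nabla f(x),u-x\rangle+D_\varphi(u,x)\}$ has a unique solution $x_\tau^+$, and $x_\tau^+\in\operatorname{int}C$. (B) There are $\theta:\mathbb{R}_{++}\to\mathbb{R}_{++}$ and $\eta>0$ such that for all $x\in\operatorname{int}C$ and $\tau>0$: $D_\varphi(x,x_\tau^+)\ge\theta(\tau)D_\varphi(x,x_1^+)$ and $D_\varphi(x,x_1^+)\ge\eta\,(f(x)-f^{\min})$. (D) For each $\ell\in\{1,\dots,\mathcal{L}\}$ there is $L_\ell>0$ such that $f_\ell$ is $L_\ell$-smooth relative to $\varphi_\ell$ on $C_\ell^k$ for all $k$, and each subproblem $\min_{u\in C_\ell^k}\{\tau_\ell\langle\nabla\psi_\ell^k(x),u-x\rangle+D_{\varphi_\ell}(u,x)\}$ ($x\in\operatorname{int}C_\ell^k$) has a unique solution, lying in $\operatorname{int}C_\ell^k$. Let $\tau\in(0,L^{-1}]$ and $\tau_\ell\in(0,L_\ell^{-1}]$ be constant step sizes, and let $\{x^k\}_{k\in\mathbb{N}}$ be generated by the multilevel BPGD algorithm (described in the context) from $x^0\in\operatorname{int}C$,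 with Armijo backtracking with parameter $\sigma\in(0,1)$ used on all levels. Then the function values $f(x^k)$ converge. More precisely, with $r:=\frac{\theta(\tau)\eta}{\tau}$, for every $k$, $$f(x^k)-f^{\min}\le(1-r)^k\,(f(x^0)-f^{\min})-\sum_{t=0}^{k-1}(1-r)^{k-t}\rho^t,$$ where $$\rho^t=\begin{cases}\displaystyle\sum_{\ell=1}^{\mathcal{L}_t}\Big(\prod_{j=0}^{\ell-1}\sigma\alpha_j^t\Big)\sum_{i=1}^{m_\ell}\frac1{\tau_\ell}D_{\varphi_\ell}(x_\ell^{i-1,t},x_\ell^{i,t}),&\text{if iteration } t\text{ triggers a coarse correction},\\[2mm]0,&\text{otherwise,}\end{cases}$$ and $\mathcal{L}_t$ is the coarsest level visited in iteration $t$.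
   Context: $\operatorname{int}$ denotes the interior (relative interior if the set has empty interior). $\mathbb{R}_{++}=(0,\infty)$. Bregman divergence: $D_\varphi(x,y)=\varphi(x)-\varphi(y)-\langle\nabla\varphi(y),x-y\rangle$. A function $g$ is $L$-smooth relative to $\varphi$ on a convex set $K$ if $D_g(x,y)\le L D_\varphi(x,y)$ for all $x\in K$, $y\in\operatorname{int}K$. The reference functions $\varphi$ and $\varphi_\ell$ are convex, extended-real-valued, strictly convex on $C$ respectively on all $C_\ell^k$, and differentiable on the interior of their domains, which contain $\operatorname{int}C$ respectively $\operatorname{int}C_\ell^k$. Levels $0$ (finest) to $\mathcal{L}$ (coarsest) have dimensions $n=n_0>n_1>\dots>n_{\mathcal{L}}$. Linear restrictions $R_\ell:\mathbb{R}^{n_\ell}\to\mathbb{R}^{n_{\ell+1}}$ and prolongations $P_\ell=R_\ell^\top$ are given. Conventions for level $0$: $\psi_0^k=f$, $C_0^k=C$, $\varphi_0=\varphi$, $\tau_0=\tau$, $x_0^{m_0,k}=x^k$, $x_0^{k+1}=x^{k+1}$. The $f_\ell$ are differentiable where needed. Multilevel BPGD algorithm (V-cycle), iteration $k$, from $x^k\in\operatorname{int}C$: Downward pass: starting with $\ell=0$, while $\ell<\mathcal{L}$ and a given criterion triggers a coarse correction at $x_\ell^{m_\ell,k}$, set $x_{\ell+1}^{0,k}=R_\ell x_\ell^{m_\ell,k}$; define the coarse model $\psi_{\ell+1}^k(x)=f_{\ell+1}(x)+\langle v_{\ell+1}^k,x-x_{\ell+1}^{0,k}\rangle$, $v_{\ell+1}^k=R_\ell\nabla\psi_\ell^k(x_\ell^{m_\ell,k})-\nabla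 f_{\ell+1}(x_{\ell+1}^{0,k})$; choose a closed convex set $C_{\ell+1}^k\subseteq\{w\in\mathbb{R}^{n_{\ell+1}}:x_\ell^{m_\ell,k}+P_\ell(w-x_{\ell+1}^{0,k})\in C_\ell^k\}$ with $x_{\ell+1}^{0,k}\in\operatorname{int}C_{\ell+1}^k$; and perform $m_{\ell+1}\ge1$ steps $x_{\ell+1}^{i,k}=\arg\min_{u\in C_{\ell+1}^k}\{\tau_{\ell+1}\langle\nabla\psi_{\ell+1}^k(x_{\ell+1}^{i-1,k}),u-x_{\ell+1}^{i-1,k}\rangle+D_{\varphi_{\ell+1}}(u,x_{\ell+1}^{i-1,k})\}$, $i=1,\dots,m_{\ell+1}$; then replace $\ell$ by $\ell+1$. Let $\mathcal{L}_k$ be the level at which the downward pass stops; iteration $k$ triggers a coarse correction iff $\mathcal{L}_k\ge1$. Upward pass (if $\mathcal{L}_k\ge1$): set $x_{\mathcal{L}_k}^{k+1}=x_{\mathcal{L}_k}^{m_{\mathcal{L}_k},k}$. For $\ell=\mathcal{L}_k-1,\dots,0$: set $d_\ell^k=P_\ell(x_{\ell+1}^{k+1}-x_{\ell+1}^{0,k})$; find $\alpha_\ell^k\in(0,1]$ by Armijo backtracking for $\psi_\ell^k$ at $x_\ell^{m_\ell,k}$ along $d_\ell^k$; set $z_\ell^{k+1}=x_\ell^{m_\ell,k}+\alpha_\ell^kd_\ell^k\in\operatorname{int}C_\ell^k$; and set $x_\ell^{k+1}=\arg\min_{u\in C_\ell^k}\{\tau_\ell\langle\nabla\psi_\ell^k(z_\ell^{k+1}),u-z_\ell^{k+1}\rangle+D_{\varphi_\ell}(u,z_\ell^{k+1})\}$.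 Finally $x^{k+1}=x_0^{k+1}$. If $\mathcal{L}_k=0$: $x^{k+1}=(x^k)_\tau^+$. Armijo backtracking for a function $g$ at $x$ along $d$, with constants $\bar\alpha>0$, $\beta,\sigma\in(0,1)$: $\alpha=\beta^p\bar\alpha$, with $p$ the smallest nonnegative integer such that $g(x+\alpha d)\le g(x)+\sigma\alpha\langle\nabla g(x),d\rangle$. It is understood that the parameters are such that $\alpha_\ell^k\in(0,1]$ and $z_\ell^{k+1}\in\operatorname{int}C_\ell^k$. *)

(* Defs.v *)
From HB Require Import structures.
From mathcomp Require Import all_boot all_order all_algebra.
From mathcomp Require Import all_classical all_reals all_analysis.

Set Implicit Arguments.
Unset Strict Implicit.
Unset Printing Implicit Defensive.

Import Order.TTheory GRing.Theory Num.Theory.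
Import numFieldNormedType.Exports.

Local Open Scope classical_set_scope.
Local Open Scope ring_scope.

Section EuclideanConvexAnalysis.
Context {R : realType} {n : nat}.
Implicit Types (A C : set 'cV[R]_n) (g phi : 'cV[R]_n -> \bar R).
Implicit Types (x y u v d : 'cV[R]_n).

Definition dotp u v : R := (u^T *m v) 0 0.

Definition affine_hull A : set 'cV[R]_n :=
  [set y | exists (p : nat) (a : 'I_p -> 'cV[R]_n) (c : 'I_p -> R),
     [/\ forall i, A (a i), \sum_i c i = 1 & y = \sum_i c i *: a i]].

Definition rel_interior A : set 'cV[R]_n :=
  [set x | A x /\
     exists2 e : R, 0 < e & ball x e `&` affine_hull A `<=` A].

(* The topological interior, or the relative interior when the former is
   empty. *)
Definition int_ A : set 'cV[R]_n :=
  [set x | A° x \/ (A° = set0 /\ rel_interior A x)].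

Definition edom g : set 'cV[R]_n := [set x | (g x < +oo)%E].

(* A real-valued function on C, seen as a function to ]-oo, +oo] with
   effective domain C; the values of f outside C play no role. *)
Definition ext_fun C (f : 'cV[R]_n -> R) : 'cV[R]_n -> \bar R :=
  fun x => if x \in C then (f x)%:E else +oo%E.

(* Convexity for functions with values in ]-oo, +oo]. *)
Definition econvex g : Prop :=
  (forall x, (-oo < g x)%E) /\
  (forall x y (t : R), 0 <= t <= 1 ->
     (g (t *: x + (1 - t) *: y)%R <= t%:E * g x + (1 - t)%:E * g y)%E).

(* The strict inequality is required between points where g is finite: it
   could not hold along a segment of the boundary of A on which g is +oo. *)
Definition estrictly_convex_on A g : Prop :=
  forall x y (t : R), (A `&` edom g) x -> (A `&` edom g) y -> x != y ->
    0 < t < 1 ->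
    (g (t *: x + (1 - t) *: y)%R < t%:E * g x + (1 - t)%:E * g y)%E.

(* First-order expansion of g at x relative to its effective domain.  At a
   point interior to the domain this is Frechet differentiability with
   gradient v; it also makes sense at boundary points, and when the domain has
   empty interior, in which case v is only determined up to a vector
   orthogonal to the affine hull of the domain. *)
Definition is_gradient g x v : Prop :=
  g x \is a fin_num /\
  forall e : R, 0 < e -> \forall y \near within (edom g) (nbhs x),
    `|fine (g y) - fine (g x) - dotp v (y - x)| <= e * `|y - x|.

Definition has_gradient g x : Prop := exists v, is_gradient g x v.

Definition grad g x : 'cV[R]_n := xget 0 [set v | is_gradient g x v].

Definition bregman phi x y : \bar R :=
  (phi x - phi y - (dotp (grad phi y) (x - y)%R)%:E)%E.

Definition rel_smooth (L : R) g phi C : Prop :=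
  forall x y, C x -> int_ C y -> (bregman g x y <= L%:E * bregman phi x y)%E.

(* u minimizes tau <grad g x, . - x> + D_phi(., x) over C. *)
Definition bregman_step C phi (tau : R) g x u : Prop :=
  let obj w := ((tau * dotp (grad g x) (w - x)%R)%:E + bregman phi w x)%E in
  C u /\ forall w, C w -> (obj u <= obj w)%E.

Definition unique_bregman_step C phi (tau : R) g : Prop :=
  forall x, int_ C x ->
    exists2 u, int_ C u & unique (bregman_step C phi tau g x) u.

Definition armijo_cond (sigma : R) g x d (a : R) : Prop :=
  (g (x + a *: d)%R <= g x + (sigma * a * dotp (grad g x) d)%:E)%E.

Definition armijo (abar beta sigma : R) g x d (a : R) : Prop :=
  exists p : nat,
    [/\ a = beta ^+ p * abar,
        armijo_cond sigma g x d a &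
        forall q : nat, (q < p)%N ->
          ~ armijo_cond sigma g x d (beta ^+ q * abar)].

Definition reference_on phi C : Prop :=
  estrictly_convex_on C phi /\ int_ C `<=` int_ (edom phi).

Definition reference_fun phi : Prop :=
  econvex phi /\ forall y, int_ (edom phi) y -> has_gradient phi y.

End EuclideanConvexAnalysis.

(* The objects produced by one iteration k.  Only the entries at the levels
   l <= coarsest are meaningful.  At level 0, the iterate x^k is
   iterate 0 (m 0); the other values iterate 0 i are not used. *)
Record vcycle (R : realType) (n : nat -> nat) := VCycle {
  coarsest : nat;                                   (* L_k *)
  feasible : forall l, set 'cV[R]_(n l);            (* C_l^k *)
  iterate : forall l : nat, nat -> 'cV[R]_(n l);    (* x_l^{i,k} *)
  corrected : forall l, 'cV[R]_(n l);               (* z_l^{k+1} *)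
  output : forall l, 'cV[R]_(n l);                  (* x_l^{k+1} *)
  stepsize : nat -> R                               (* alpha_l^k *)
}.

Arguments feasible {R n} v l _.

Section MultilevelBPGD.
Context {R : realType} {n : nat -> nat}.

Variables (LL : nat) (Rst : forall l, 'M[R]_(n l.+1, n l)).
Variables (C : set 'cV[R]_(n 0%N)) (f : 'cV[R]_(n 0%N) -> R).
(* The coarse functions; fc 0 is not used. *)
Variable fc : forall l, 'cV[R]_(n l) -> \bar R.
Variable phi : forall l, 'cV[R]_(n l) -> \bar R.
Variables (tau : nat -> R) (m : nat -> nat) (abar beta sigma : R).

(* psi_l^k; psi_0^k is f with value +oo outside C. *)
Fixpoint model (c : vcycle R n) (l : nat) : 'cV[R]_(n l) -> \bar R :=
  match l return 'cV[R]_(n l) -> \bar R with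
  | 0%N => ext_fun C f
  | l'.+1 =>
      let x0 := iterate c l'.+1 0 in
      let v := Rst l' *m grad (@model c l') (iterate c l' (m l'))
               - grad (@fc l'.+1) x0 in
      fun x => (fc x + (dotp v (x - x0)%R)%:E)%E
  end.

Definition level_step (c : vcycle R n) (l : nat) (x u : 'cV[R]_(n l)) : Prop :=
  bregman_step (feasible c l) (@phi l) (tau l) (@model c l) x u.

Definition restrict_level (c : vcycle R n) (l : nat) : Prop :=
  let xl := iterate c l (m l) in
  let x0 := iterate c l.+1 0 in
  x0 = Rst l *m xl /\
  [/\ closed (feasible c l.+1),
      convex_set (feasible c l.+1),
      feasible c l.+1 `<=`
        [set w | feasible c l (xl + (Rst l)^T *m (w - x0))] &
      int_ (feasible c l.+1) x0] /\
  (forall i, (i < m l.+1)%N ->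
     level_step c (iterate c l.+1 i) (iterate c l.+1 i.+1)).

Definition prolong_level (c : vcycle R n) (l : nat) : Prop :=
  let xl := iterate c l (m l) in
  let d := (Rst l)^T *m (output c l.+1 - iterate c l.+1 0) in
  [/\ armijo abar beta sigma (@model c l) xl d (stepsize c l),
      0 < stepsize c l <= 1,
      corrected c l = xl + stepsize c l *: d,
      int_ (feasible c l) (corrected c l) &
      level_step c (corrected c l) (output c l)].

(* c is an iteration of the V-cycle from x to x'; crit l is the criterion
   that triggers a coarse correction at level l. *)
Definition is_iteration (crit : forall l, 'cV[R]_(n l) -> Prop)
    (x x' : 'cV[R]_(n 0%N)) (c : vcycle R n) : Prop :=
  let top := coarsest c in
  [/\ [/\ feasible c 0%N = C, iterate c 0%N (m 0%N) = x
        & output c 0%N = x'],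
      [/\ (top <= LL)%N,
          forall l, (l < top)%N -> crit l (iterate c l (m l)) &
          (top < LL)%N -> ~ crit top (iterate c top (m top))],
      forall l, (l < top)%N -> restrict_level c l &
      if (0 < top)%N then
        output c top = iterate c top (m top) /\
        forall l, (l < top)%N -> prolong_level c l
      else level_step c x x'].

(* rho^t; the divergences are finite, their arguments being interior. *)
Definition coarse_decrease (c : vcycle R n) : R :=
  if (0 < coarsest c)%N then
    \sum_(1 <= l < (coarsest c).+1)
      (\prod_(0 <= j < l) (sigma * stepsize c j)) *
      \sum_(1 <= i < (m l).+1)
        (tau l)^-1 *
        fine (bregman (@phi l) (iterate c l i.-1) (iterate c l i))
  else 0.

End MultilevelBPGD.

Arguments model {R n} Rst C f fc m c l _.

(* Main.v *)
Require Import Defs.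
From HB Require Import structures.
From mathcomp Require Import all_boot all_order all_algebra.
From mathcomp Require Import all_classical all_reals all_analysis.
From mathcomp Require Import ring lra.

Set Implicit Arguments.
Unset Strict Implicit.
Unset Printing Implicit Defensive.

Import Order.TTheory GRing.Theory Num.Theory.
Import numFieldNormedType.Exports.

Local Open Scope classical_set_scope.
Local Open Scope ring_scope.

(** Three estimates carry the proof.

    A Bregman proximal step from x to u with step size at most 1/L decreases
    the model psi by at least D_phi(x, u) / tau ([step_decrease]): this adds
    the first-order optimality of u, tested along the segment from u to x
    ([step_optimality]), to the relative smoothness of psi.

    A V-cycle is a telescope over levels.  The linear term of the coarse model
    is chosen so that its gradient at the restricted point is the restriction
    of the finer gradient.  As the prolongation is the transpose of the
    restriction, the slope of the finer model along the prolonged correction d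
    equals the slope of the coarse model along the coarse correction, which by
    convexity is at most the change of the coarse model.  The Armijo condition
    thus turns a decrease at level l+1 into sigma * alpha times that decrease
    at level l ([corrected_le]).  Unrolling this down to the finest level shows
    that the corrected point z satisfies f z <= f x - rho
    ([cycle_decrease]).

    The last fine step, from z, contracts the gap f - fmin by the factor 1 - r
    because the assumptions on theta and eta bound the divergence of the step
    from below by a multiple of the gap.  Hence
    gap (t+1) <= (1 - r) * (gap t - rho t), which [linear_rate] iterates.

    Values are extended reals and gradients are chosen by [grad] among all
    first-order expansions relative to the domain, which need not be unique.
    For a convex function the product of a gradient at x with y - x, for y in
    the domain, is nevertheless the one-sided derivative along the segment,
    so that the choice does not matter ([gradient_unique_along]). *)

(** * Gradients of convex extended-valued functions *)

Section DotProduct.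
Context {R : realType} {n : nat}.
Implicit Types u v w : 'cV[R]_n.

Lemma dotpDl u v w : dotp (u + v) w = dotp u w + dotp v w.
Proof. by rewrite /dotp linearD mulmxDl mxE. Qed.

Lemma dotpNl u w : dotp (- u) w = - dotp u w.
Proof. by rewrite /dotp linearN mulNmx mxE. Qed.

Lemma dotpDr u v w : dotp u (v + w) = dotp u v + dotp u w.
Proof. by rewrite /dotp mulmxDr mxE. Qed.

Lemma dotpNr u w : dotp u (- w) = - dotp u w.
Proof. by rewrite /dotp mulmxN mxE. Qed.

Lemma dotpZr (a : R) u w : dotp u (a *: w) = a * dotp u w.
Proof. by rewrite /dotp -scalemxAr mxE. Qed.

End DotProduct.

Lemma dotp_trmul (R : realType) (p q : nat) (A : 'M[R]_(q, p)) u w :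
  dotp u (A^T *m w) = dotp (A *m u) w.
Proof. by rewrite /dotp mulmxA trmx_mul. Qed.

Section ConvexGradient.
Context {R : realType} {n : nat}.
Implicit Types (g phi : 'cV[R]_n -> \bar R) (x y u v w a : 'cV[R]_n).

Lemma econvex_fin g x : econvex g -> edom g x -> g x \is a fin_num.
Proof. by move=> -[gN _] gx; rewrite fin_real// gN. Qed.

Lemma segmentE x y (t : R) : x + t *: (y - x) = t *: y + (1 - t) *: x.
Proof. by rewrite scalerBr scalerBl scale1r addrCA addrA addrC !addrA. Qed.

Lemma econvex_segment g x y (t : R) : econvex g -> edom g x -> edom g y ->
  0 <= t <= 1 ->
  edom g (x + t *: (y - x)) /\
  fine (g (x + t *: (y - x))) <= fine (g x) + t * (fine (g y) - fine (g x)).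
Proof.
move=> gc gx gy t01; have [_ gle] := gc.
have := gle y x t t01; rewrite -segmentE.
rewrite -(fineK (econvex_fin gc gx)) -(fineK (econvex_fin gc gy)).
rewrite -!EFinM -EFinD => le_z.
have gz : edom g (x + t *: (y - x)) by apply: (le_lt_trans le_z); rewrite ltry.
split => //; move: le_z; rewrite -(fineK (econvex_fin gc gz)) lee_fin /=.
by move/le_trans; apply; lra.
Qed.

(** The expansion of g at x, restricted to the segment towards y, which
    convexity keeps in the domain: the expansion relative to the domain applies
    along it. *)
Lemma gradient_along g x v y (e : R) : econvex g -> edom g y ->
  is_gradient g x v -> 0 < e ->
  \forall t \near 0^'+,
    `|fine (g (x + t *: (y - x))) - fine (g x) - t * dotp v (y - x)| <= e * t.
Proof.
move=> gc gy [gx hv] e0.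
have gx' : edom g x by rewrite /edom/= ltey_eq gx.
have M0 : 0 < `|y - x| + 1 by rewrite ltr_wpDl.
have := hv _ (divr_gt0 e0 M0); rewrite near_withinE => hnb.
have cv : x + t *: (y - x) @[t --> 0^'+] --> x.
  apply: cvg_at_right_filter.
  rewrite -[in X in _ --> X](addr0 x) -(scale0r (y - x)).
  by apply: cvgD; [exact: cvg_cst | apply: cvgZr_tmp; exact: cvg_id].
near=> t.
have t0 : 0 < t by near: t; exact: nbhs_right_gt.
have t1 : t <= 1 by near: t; exact: nbhs_right_le.
have dz : edom g (x + t *: (y - x)).
  by have [] := @econvex_segment g x y t gc gx' gy _; rewrite ?(ltW t0).
have : `|fine (g (x + t *: (y - x))) - fine (g x)
         - dotp v (x + t *: (y - x) - x)|
       <= e / (`|y - x| + 1) * `|x + t *: (y - x) - x|.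
  move: dz; near: t; exact: (cv _ hnb).
rewrite [x + _ - x]addrAC subrr add0r dotpZr => /le_trans; apply.
rewrite normrZ (gtr0_norm t0) mulrCA [e * t]mulrC ler_pM2l//.
by rewrite -mulrA ger_pMr// mulrC ler_pdivrMr// mul1r lerDl.
Unshelve. all: by end_near. Qed.

(** By [gradient_along], the product with y - x is a one-sided derivative: a
    bound on the difference quotients for small t passes to the limit. *)
Lemma gradient_ge g x v y (c : R) : econvex g -> edom g y ->
  is_gradient g x v ->
  (\forall t \near 0^'+, t * c <= fine (g (x + t *: (y - x))) - fine (g x)) ->
  c <= dotp v (y - x).
Proof.
move=> gc gy hv hc; apply/ler_addgt0Pr => e e0.
have [t [t0 [ht /ler_normlP[_ ha]]]] := filter_ex (filterI (nbhs_right_gt 0)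
  (filterI hc (gradient_along gc gy hv e0))).
by rewrite -(ler_pM2l t0) mulrDr (mulrC t e); lra.
Qed.

Lemma gradient_le g x v y (c : R) : econvex g -> edom g y ->
  is_gradient g x v ->
  (\forall t \near 0^'+, fine (g (x + t *: (y - x))) - fine (g x) <= t * c) ->
  dotp v (y - x) <= c.
Proof.
move=> gc gy hv hc; apply/ler_addgt0Pr => e e0.
have [t [t0 [ht /ler_normlP[ha _]]]] := filter_ex (filterI (nbhs_right_gt 0)
  (filterI hc (gradient_along gc gy hv e0))).
by rewrite -(ler_pM2l t0) mulrDr (mulrC t e); lra.
Qed.

Lemma gradient_edom g x v : is_gradient g x v -> edom g x.
Proof. by case=> gx _; rewrite /edom/= ltey_eq gx. Qed.

Lemma gradient_ineq g x v y : econvex g -> is_gradient g x v -> edom g y ->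
  dotp v (y - x) <= fine (g y) - fine (g x).
Proof.
move=> gc hv gy; apply: (gradient_le gc gy hv); near=> t.
rewrite lerBlDl; apply: (econvex_segment gc (gradient_edom hv) gy _).2.
by rewrite ltW //=; near: t; exact: nbhs_right_le.
Unshelve. all: by end_near. Qed.

Lemma gradient_unique_along g x v w y : econvex g -> edom g y ->
  is_gradient g x v -> is_gradient g x w -> dotp v (y - x) = dotp w (y - x).
Proof.
move=> gc gy hv hw; apply/eqP; rewrite -subr_eq0 -normr_le0.
apply/ler_addgt0Pr => e e0; rewrite add0r.
have e2 : 0 < e / 2 by rewrite divr_gt0.
have [t [t0 [/ler_normlP[h1 h2] /ler_normlP[h3 h4]]]] :=
  filter_ex (filterI (nbhs_right_gt 0)
    (filterI (gradient_along gc gy hv e2) (gradient_along gc gy hw e2))).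
rewrite -(ler_pM2l t0) -{1}(gtr0_norm t0) -normrM mulrBr (mulrC t e).
by apply/ler_normlP; split; lra.
Qed.

Lemma gradP g x : has_gradient g x -> is_gradient g x (grad g x).
Proof. exact: xgetPex. Qed.

(** A coarse model is a coarse function with such an affine term added. *)
Definition tilt g w a : 'cV[R]_n -> \bar R :=
  fun x => (g x + (dotp w (x - a))%:E)%E.

Lemma edom_tilt g w a : edom (tilt g w a) = edom g.
Proof.
by apply/seteqP; split=> x; rewrite /edom /tilt /=; case: (g x) => //= r _;
  rewrite -?EFinD ltry.
Qed.

Lemma fine_tilt g w a x : g x \is a fin_num ->
  fine (tilt g w a x) = fine (g x) + dotp w (x - a).
Proof. by move=> gx; rewrite fineD. Qed.

Lemma econvex_tilt g w a : econvex g -> econvex (tilt g w a).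
Proof.
move=> [gN gle]; split=> [x|x y t t01].
  by have := gN x; rewrite /tilt; case: (g x) => //= r _; rewrite -EFinD ltNyr.
rewrite /tilt; have -> : dotp w (t *: x + (1 - t) *: y - a)
    = t * dotp w (x - a) + (1 - t) * dotp w (y - a).
  rewrite -2!dotpZr -dotpDr; congr dotp.
  by rewrite !scalerBr addrACA -opprD -scalerDl addrCA subrr addr0 scale1r.
rewrite EFinD !EFinM !muleDr ?fin_num_adde_defl// addeACA.
by apply: leeD2r; exact: gle.
Qed.

Lemma gradient_tilt g w a x v : econvex g ->
  is_gradient g x v -> is_gradient (tilt g w a) x (v + w).
Proof.
move=> gc [gx hv]; split; first by rewrite fin_numD gx.
move=> e e0; rewrite edom_tilt; have := hv e e0; rewrite !near_withinE.
apply: filterS => y hy gy; have := hy gy.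
congr (_ <= _); congr `| _ |; rewrite !fine_tilt ?(econvex_fin gc gy)//.
by rewrite !(dotpDr, dotpDl, dotpNr); ring.
Qed.

(** The gradient chosen for the tilted function may differ from the tilted
    gradient, but not along directions towards the domain. *)
Lemma dotp_grad_tilt g w a x y : econvex g -> has_gradient g x -> edom g y ->
  dotp (grad (tilt g w a) x) (y - x) = dotp (grad g x + w) (y - x).
Proof.
move=> gc /gradP hv gy; have hw := gradient_tilt w a gc hv.
apply: (gradient_unique_along (econvex_tilt w a gc)) => //.
- by rewrite edom_tilt.
- by apply: gradP; exists (grad g x + w).
Qed.

Lemma bregman_fine phi x y : phi x \is a fin_num -> phi y \is a fin_num ->
  fine (bregman phi x y) =
  fine (phi x) - fine (phi y) - dotp (grad phi y) (x - y).
Proof. by move=> px py; rewrite /bregman !fineB ?fin_numB ?px. Qed.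

Lemma bregman_fin_num phi x y : phi x \is a fin_num -> phi y \is a fin_num ->
  bregman phi x y \is a fin_num.
Proof. by move=> px py; rewrite /bregman !fin_numB px py. Qed.

Lemma bregman_ge0 phi x y : econvex phi -> edom phi x -> has_gradient phi y ->
  0 <= fine (bregman phi x y).
Proof.
move=> pc px /gradP hy; rewrite bregman_fine ?(econvex_fin pc)// ?hy.1//.
  by rewrite subr_ge0 gradient_ineq.
exact: gradient_edom hy.
Qed.

(** Affine terms cancel in the divergence, hence relative smoothness passes
    from a coarse function to its model. *)
Lemma bregman_tilt g w a x y : econvex g -> has_gradient g y ->
  bregman (tilt g w a) x y = bregman g x y.
Proof.
move=> gc hy; have [gy _] := gradP hy.
have [gx|] := pselect (edom g x); last first.
  move/negP; rewrite -leNgt leye_eq => /eqP gx.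
  by rewrite /bregman /tilt gx -(fineK gy).
rewrite /bregman dotp_grad_tilt// /tilt -(fineK gy).
rewrite -(fineK (econvex_fin gc gx)) -!(EFinD, EFinN); congr EFin.
by rewrite !(dotpDr, dotpDl, dotpNr); ring.
Qed.

Lemma econvex_ext_fun (K : set 'cV[R]_n) (f : 'cV[R]_n -> R) :
  convex_set K -> convex_function K f -> econvex (ext_fun K f).
Proof.
move=> Kc fc; split=> [x|x y t /andP[t0 t1]].
  by rewrite /ext_fun; case: ifP => _; rewrite ?ltNyr// ltNy0.
(* The endpoints are separate: there the product of 0 with +oo is 0. *)
rewrite /ext_fun; have [t0'|tp] := eqVneq t 0.
  by rewrite t0' scale0r add0r subr0 scale1r mul0e add0e mul1e.
have [t1'|tn] := eqVneq t 1.
  by rewrite t1' subrr scale0r addr0 scale1r mul0e adde0 mul1e.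
have tpos : 0 < t by rewrite lt_neqAle eq_sym tp.
have tlt : 0 < 1 - t by rewrite subr_gt0 lt_neqAle tn.
have [xK|xK] := boolP (x \in K); have [yK|yK] := boolP (y \in K).
- have zK := Kc x y (Itv01 t0 t1) xK yK; rewrite ifT//.
  exact: (fc (Itv01 t0 t1) x y xK yK).
- by rewrite (gt0_muley _) ?lte_fin// addey ?leey.
- by rewrite (gt0_muley _) ?lte_fin// addye ?leey.
- by rewrite !(gt0_muley _) ?lte_fin// leey.
Qed.

(** * One Bregman proximal gradient step *)

Lemma int_subset (K : set 'cV[R]_n) : int_ K `<=` K.
Proof. by move=> x [/interior_subset//|[_ []]]. Qed.

Lemma convex_segment (K : set 'cV[R]_n) x y (t : R) :
  convex_set K -> K x -> K y -> 0 <= t <= 1 -> K (x + t *: (y - x)).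
Proof.
move=> Kc Kx Ky /andP[t0 t1]; rewrite segmentE.
by have := Kc y x (Itv01 t0 t1); rewrite !inE; exact.
Qed.

(** The hypotheses under which the step is analysed; they hold at the finest
    level and at each visited coarse level alike. *)
Record bpgd_setting (K : set 'cV[R]_n) phi psi (L tau : R) : Prop :=
  BpgdSetting {
  setting_set : convex_set K;
  setting_phi : reference_fun phi;
  setting_ref : reference_on phi K;
  setting_psi : econvex psi;
  setting_diff : forall y, int_ K y -> has_gradient psi y;
  setting_smooth : rel_smooth L psi phi K;
  setting_step : unique_bregman_step K phi tau psi;
  setting_tau : 0 < tau <= L^-1 }.

Section BregmanStep.
Variables (K : set 'cV[R]_n) (phi psi : 'cV[R]_n -> \bar R) (L tau : R).
Hypothesis hS : bpgd_setting K phi psi L tau.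

Lemma setting_grad_phi y : int_ K y -> is_gradient phi y (grad phi y).
Proof.
move=> Ky; apply: gradP; apply: (setting_phi hS).2.
exact: (setting_ref hS).2.
Qed.

Lemma setting_fin_phi y : int_ K y -> phi y \is a fin_num.
Proof. by move=> /setting_grad_phi[]. Qed.

Lemma setting_fin_psi y : int_ K y -> psi y \is a fin_num.
Proof. by move=> /(setting_diff hS)/gradP[]. Qed.

Lemma step_int x u : int_ K x -> bregman_step K phi tau psi x u -> int_ K u.
Proof.
by move=> Kx hu; have [u' Ku' [_ /(_ _ hu) <-]] := setting_step hS Kx.
Qed.

Lemma step_bregman_ge0 x u : int_ K x -> int_ K u ->
  0 <= fine (bregman phi x u).
Proof.
move=> Kx Ku; apply: bregman_ge0; first exact: (setting_phi hS).1.
  exact: gradient_edom (setting_grad_phi Kx).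
by exists (grad phi u); exact: setting_grad_phi.
Qed.

(** Moving from the minimizer u a small amount t towards x cannot decrease the
    objective; dividing by t and letting t tend to 0 gives the inequality, as
    D(x, u) + D(u, x) = <grad phi x - grad phi u, x - u>. *)
Lemma step_optimality x u : int_ K x -> bregman_step K phi tau psi x u ->
  tau * dotp (grad psi x) (u - x) <=
  - fine (bregman phi x u) - fine (bregman phi u x).
Proof.
move=> Kx hu; have Ku := step_int Kx hu.
have [pc _] := setting_phi hS.
have gx := setting_grad_phi Kx; have gu := setting_grad_phi Ku.
have fx := setting_fin_phi Kx; have fu := setting_fin_phi Ku.
have : dotp (grad phi x) (x - u) - tau * dotp (grad psi x) (x - u)
    <= dotp (grad phi u) (x - u).
  apply: (gradient_ge pc (gradient_edom gx) gu); near=> t.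
  have t01 : 0 <= t <= 1.
    by rewrite ltW //=; near: t; exact: nbhs_right_le.
  have Kw := convex_segment (setting_set hS) hu.1 (int_subset Kx) t01.
  have [dw _] := econvex_segment pc (gradient_edom gu) (gradient_edom gx) t01.
  have fw := econvex_fin pc dw.
  have := hu.2 _ Kw; rewrite -(fineK (bregman_fin_num fu fx)).
  rewrite -(fineK (bregman_fin_num fw fx)) -!EFinD lee_fin !bregman_fine//.
  have -> : u + t *: (x - u) - x = (u - x) + t *: (x - u) by rewrite addrAC.
  by rewrite !(dotpDr, dotpZr, dotpNr); lra.
rewrite !bregman_fine// -(opprB x u) !dotpNr.
move: (dotp (grad phi x) _) (dotp (grad phi u) _) (dotp (grad psi x) _).
by move=> p q s; lra.
Unshelve. all: by end_near. Qed.

(** Relative smoothness costs L * D(u, x), which the term - D(u, x) / tau of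
    [step_optimality] pays for; what is left is - D(x, u) / tau. *)
Lemma step_decrease x u : int_ K x -> bregman_step K phi tau psi x u ->
  fine (psi u) <= fine (psi x) - tau^-1 * fine (bregman phi x u).
Proof.
move=> Kx hu; have Ku := step_int Kx hu.
have /andP[tau0 tauL] := setting_tau hS.
have L0 : 0 < L by rewrite -invr_gt0; exact: lt_le_trans tauL.
have Ltau : L <= tau^-1 by rewrite -(invrK L) lef_pV2// posrE invr_gt0.
have fx := setting_fin_phi Kx; have fu := setting_fin_phi Ku.
have gx := setting_fin_psi Kx; have gu := setting_fin_psi Ku.
have := setting_smooth hS (int_subset Ku) Kx.
rewrite -(fineK (bregman_fin_num fu fx)) -(fineK (bregman_fin_num gu gx)).
rewrite -EFinM lee_fin [fine (bregman psi _ _)]bregman_fine// => hs.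
have := step_optimality Kx hu; rewrite mulrC -ler_pdivlMr// => ho.
have hL : L * fine (bregman phi u x) <= tau^-1 * fine (bregman phi u x).
  by rewrite ler_wpM2r// step_bregman_ge0.
by rewrite mulrDl !mulNr ![_ / tau]mulrC in ho; lra.
Qed.

End BregmanStep.

Lemma tilt_setting K phi g (L tau : R) w a :
  convex_set K -> reference_fun phi -> reference_on phi K -> econvex g ->
  (forall y, int_ K y -> has_gradient g y) -> rel_smooth L g phi K ->
  unique_bregman_step K phi tau (tilt g w a) -> 0 < tau <= L^-1 ->
  bpgd_setting K phi (tilt g w a) L tau.
Proof.
move=> Kc pr pK gc gd gs hstep htau; split=> //; first exact: econvex_tilt.
  move=> y /gd/gradP hy; exists (grad g y + w); exact: gradient_tilt.
by move=> x y Kx Ky; rewrite bregman_tilt//; [exact: gs | exact: gd].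
Qed.

End ConvexGradient.

(** * One V-cycle *)

Section OneCycle.
Context {R : realType} {n : nat -> nat}.
Variables (Rst : forall l, 'M[R]_(n l.+1, n l)).
Variables (C : set 'cV[R]_(n 0%N)) (f : 'cV[R]_(n 0%N) -> R).
Variables (fc phi : forall l, 'cV[R]_(n l) -> \bar R).
Variables (L tau : nat -> R) (m : nat -> nat) (abar beta sigma : R).
Variable c : vcycle R n.

Let top := coarsest c.
Let M l := model Rst C f fc m c l.
Let X l i := iterate c l i.
Let gain l := \sum_(1 <= i < (m l).+1)
  (tau l)^-1 * fine (bregman (@phi l) (X l i.-1) (X l i)).

Hypothesis sigma_gt0 : 0 < sigma.
Hypothesis settings : forall l, (l <= top)%N ->
  bpgd_setting (feasible c l) (@phi l) (@M l) (L l) (tau l).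
Hypothesis fc_econvex : forall l, (0 < l <= top)%N -> econvex (@fc l).
Hypothesis fc_gradient : forall l, (0 < l <= top)%N ->
  forall y, int_ (feasible c l) y -> has_gradient (@fc l) y.
Hypothesis start_int : int_ (feasible c 0) (X 0 (m 0)).
Hypothesis restricted : forall l, (l < top)%N ->
  restrict_level Rst C f fc phi tau m c l.
Hypothesis output_top : (0 < top)%N -> output c top = X top (m top).
Hypothesis prolonged : forall l, (l < top)%N ->
  prolong_level Rst C f fc phi tau m abar beta sigma c l.

Lemma iterate_int l i : (0 < l <= top)%N -> (i <= m l)%N ->
  int_ (feasible c l) (X l i).
Proof.
case: l => [|l] /andP[]; [by move=> h; case: (notF h) | move=> _ ltop].
have [_ [[_ _ _ x0] hstep]] := restricted ltop.
elim: i => [_|i IH im]; first exact: x0.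
exact: (step_int (settings ltop) (IH (ltnW im)) (hstep i im)).
Qed.

Lemma start_level_int l : (l <= top)%N -> int_ (feasible c l) (X l (m l)).
Proof. by case: l => // l ltop; exact: iterate_int. Qed.

Lemma iterate_decrease l i : (0 < l <= top)%N -> (i <= m l)%N ->
  let s := \sum_(1 <= j < i.+1)
    (tau l)^-1 * fine (bregman (@phi l) (X l j.-1) (X l j)) in
  0 <= s /\ fine (M (X l i)) <= fine (M (X l 0)) - s.
Proof.
move=> ltop /=; have xint := @iterate_int l _ ltop.
have hs : bpgd_setting (feasible c l) (@phi l) (@M l) (L l) (tau l).
  by apply: settings; case/andP: ltop.
have hstep j : (j < m l)%N ->
    level_step Rst C f fc phi tau m c (X l j) (X l j.+1).
  by case: l ltop {xint hs} => // l /andP[_ /restricted[_ [_]]]; exact.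
have tau0 : 0 <= (tau l)^-1.
  by rewrite invr_ge0 ltW//; case/andP: (setting_tau hs).
elim: i => [|i IH] im; first by rewrite big_geq// subr0.
have [s0 le_s] := IH (ltnW im); rewrite big_nat_recr//=; split.
  apply: addr_ge0 => //; apply: mulr_ge0 => //.
  exact: (step_bregman_ge0 hs (xint _ (ltnW im)) (xint _ im)).
have /= := step_decrease hs (xint _ (ltnW im)) (hstep i im); lra.
Qed.

Lemma output_int l : (0 < top)%N -> (l <= top)%N ->
  int_ (feasible c l) (output c l).
Proof.
move=> top0; rewrite leq_eqVlt => /predU1P[->|ltop].
  by rewrite output_top//; exact: start_level_int.
have [_ _ _ zint hstep] := prolonged ltop.
exact: (step_int (settings (ltnW ltop)) zint hstep).
Qed.

(** The transfer between levels: after the Armijo condition, the slope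
    <grad psi_l, P d> = <R grad psi_l, d> is a directional derivative of the
    coarse model, bounded by convexity. *)
Lemma corrected_le l : (l < top)%N ->
  fine (M (corrected c l)) <= fine (M (X l (m l))) + sigma * stepsize c l *
    (fine (M (output c l.+1)) - fine (M (X l.+1 0))).
Proof.
move=> ltop; have [[p [_ harm _]] /andP[a0 _] zE zint _] := prolonged ltop.
have [_ [[_ _ _ x0int] _]] := restricted ltop.
have hs := settings (ltnW ltop); have hs' := settings ltop.
have outint := output_int (leq_ltn_trans (leq0n l) ltop) ltop.
have fx := setting_fin_psi hs (start_level_int (ltnW ltop)).
have fz := setting_fin_psi hs zint.
move: harm; rewrite /armijo_cond -zE -[leLHS](fineK fz).
rewrite -[Y in (_ <= Y + _)%E](fineK fx) -EFinD lee_fin.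
move/le_trans; apply; rewrite lerD2l ler_pM2l ?mulr_gt0// dotp_trmul.
have lr : (0 < l.+1 <= top)%N by [].
have fcc := fc_econvex lr; have hg := fc_gradient lr x0int.
(* First-order coherence: the restricted fine gradient is a gradient of the
   coarse model at the restricted point. *)
have hM := gradient_tilt (Rst l *m grad (@M l) (X l (m l))
  - grad (@fc l.+1) (X l.+1 0)) (X l.+1 0) fcc (gradP hg).
rewrite addrCA subrr addr0 in hM.
apply: (gradient_ineq (setting_psi hs') hM).
exact: gradient_edom (gradP (setting_diff hs' outint)).
Qed.

(** The decrease at an intermediate level: the steps of the downward pass give
    gain l, the correction from the coarser level gives the last term, and the
    step after the correction does not increase the model. *)
Lemma level_le l : (0 < l < top)%N ->
  fine (M (output c l)) - fine (M (X l 0)) <= - gain l + sigma * stepsize c l *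
    (fine (M (output c l.+1)) - fine (M (X l.+1 0))).
Proof.
move=> /andP[l0 ltop]; have hs := settings (ltnW ltop).
have lr : (0 < l <= top)%N by rewrite l0 ltnW.
have [_ hS] := iterate_decrease lr (leqnn _); rewrite -/(gain l) in hS.
have hz := corrected_le ltop; have [_ _ _ zint hstep] := prolonged ltop.
have := step_decrease hs zint hstep.
have : 0 <= (tau l)^-1 * fine (bregman (@phi l) (corrected c l) (output c l)).
  have /andP[tau0 _] := setting_tau hs.
  rewrite mulr_ge0 ?invr_ge0 ?(ltW tau0)//.
  exact: (step_bregman_ge0 hs zint (step_int hs zint hstep)).
lra.
Qed.

Lemma coarse_decreaseE : (0 < top)%N ->
  coarse_decrease phi tau m sigma c =
  \sum_(1 <= l < top.+1) (\prod_(0 <= j < l) (sigma * stepsize c j)) * gain l.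
Proof. by move=> top0; rewrite /coarse_decrease ifT. Qed.

Lemma prod_step_ge0 l : (l <= top)%N ->
  0 <= \prod_(0 <= j < l) (sigma * stepsize c j).
Proof.
move=> ltop; rewrite big_nat; apply: prodr_ge0 => j /andP[_ jl].
have [_ /andP[a0 _] _ _ _] := prolonged (leq_trans jl ltop).
by rewrite mulr_ge0 ?ltW.
Qed.

Lemma coarse_decrease_ge0 : 0 <= coarse_decrease phi tau m sigma c.
Proof.
have [top0|] := ltnP 0 top; last first.
  by rewrite leqNgt /coarse_decrease => /negbTE top0; rewrite ifF.
rewrite coarse_decreaseE// big_nat; apply: sumr_ge0 => l ltop.
rewrite mulr_ge0 ?prod_step_ge0//; first by case/andP: ltop.
exact: (iterate_decrease ltop (leqnn _)).1.
Qed.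

Lemma cycle_decrease : (0 < top)%N ->
  fine (M (corrected c 0)) <=
  fine (M (X 0 (m 0))) - coarse_decrease phi tau m sigma c.
Proof.
move=> top0; rewrite coarse_decreaseE//.
(* Invariant for the levels above l: their decreases are collected, and the
   change of model l is still to be estimated. *)
have telescope l : (0 < l <= top)%N ->
    fine (M (corrected c 0)) <= fine (M (X 0 (m 0)))
    - \sum_(1 <= i < l) (\prod_(0 <= j < i) (sigma * stepsize c j)) * gain i
    + (\prod_(0 <= j < l) (sigma * stepsize c j)) *
      (fine (M (output c l)) - fine (M (X l 0))).
  elim: l => // -[|l] IH ltop.
    by rewrite [Y in _ - Y]big_geq// subr0 big_nat1; exact: corrected_le.
  have ltop' : (0 < l.+1 < top)%N by [].
  apply: le_trans (IH (ltnW ltop)) _.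
  rewrite [in leRHS]big_nat_recr//= (@big_nat_recr _ _ _ l.+1)//=.
  have := ler_wpM2l (prod_step_ge0 (ltnW ltop)) (level_le ltop'); lra.
have toprange : (0 < top <= top)%N by rewrite top0 leqnn.
apply: le_trans (telescope _ toprange) _.
rewrite big_nat_recr//= opprD addrA lerD2l -mulrN.
apply: ler_wpM2l; first exact: prod_step_ge0.
have [_ hS] := iterate_decrease toprange (leqnn _); rewrite -/(gain top) in hS.
by rewrite output_top// lerBlDl.
Qed.

End OneCycle.

(** * Rate of convergence *)

(** Here a is the gap f - fmin at the iterates, w the gap at the corrected
    points and rho the decrease of the coarse levels.  The sign of q = 1 - r is
    unknown: if q < 0, the last hypothesis (the contraction applied to the
    iterate itself) forces a = 0, hence rho = 0, and everything vanishes. *)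
Lemma linear_rate (R : realType) (q : R) (a w rho : nat -> R) :
  q < 1 -> (forall t, 0 <= a t) -> (forall t, 0 <= rho t) ->
  (forall t, 0 <= w t <= a t - rho t) -> (forall t, a t.+1 <= q * w t) ->
  (forall t, 0 <= q * a t) ->
  (a @ \oo --> 0) /\
  forall k, a k <= q ^+ k * a 0%N
                   - \sum_(0 <= t < k) q ^+ (k - t) * rho t.
Proof.
move=> q1 a0 rho0 hw ha qa; have [q0|q0] := leP 0 q; last first.
  have az t : a t = 0 by apply/le_anti; rewrite a0 -(nmulr_rge0 _ q0) qa.
  have rhoz t : rho t = 0.
    apply/le_anti; rewrite rho0 andbT.
    by have /andP[/le_trans/[apply]] := hw t; rewrite az sub0r oppr_ge0.
  split=> [|k]; last first.
    by rewrite !az mulr0 big1 ?subr0// => t; rewrite rhoz mulr0.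
  by rewrite (_ : a = fun=> 0); [exact: cvg_cst | exact/funext].
have bound k : a k <= q ^+ k * a 0%N - \sum_(0 <= t < k) q ^+ (k - t) * rho t.
  elim: k => [|k IH]; first by rewrite big_geq// mul1r subr0.
  have /andP[_ hwk] := hw k; apply: le_trans (ha k) _.
  apply: le_trans (ler_wpM2l q0 (le_trans hwk (lerB IH (lexx _)))) _.
  rewrite big_nat_recr//= subSnn expr1.
  have -> : \sum_(0 <= t < k) q ^+ (k.+1 - t) * rho t =
      q * \sum_(0 <= t < k) q ^+ (k - t) * rho t.
    rewrite mulr_sumr; apply: eq_big_nat => t /andP[_ tk].
    by rewrite subSn ?exprS ?mulrA// ltnW.
  by rewrite exprS !mulrBr mulrA opprD addrA.
split=> //; apply: (@squeeze_cvgr _ _ _ _ (fun=> 0) (fun k => a 0%N * q ^+ k)).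
- apply: nearW => k; rewrite a0 /=; apply: le_trans (bound k) _.
  rewrite mulrC lerBlDr lerDl sumr_ge0// => t _.
  by rewrite mulr_ge0 ?exprn_ge0.
- exact: cvg_cst.
- by apply: cvg_geometric; rewrite ger0_norm.
Qed.

(* The index 0 of phi, L and tau stands for the finest level: phi 0, L 0 and
   tau 0 are the phi, L and tau of the fine problem. *)
Theorem mainTheorem2 (R : realType) (LL : nat) (n : nat -> nat)
  (n_decr : forall l, (l < LL)%N -> (n l.+1 < n l)%N)
  (Rst : forall l, 'M[R]_(n l.+1, n l))
  (C : set 'cV[R]_(n 0%N)) (C_closed : closed C) (C_convex : convex_set C)
  (f : 'cV[R]_(n 0%N) -> R) (f_convex : convex_function C f)
  (f_diff : forall y, C y -> has_gradient (ext_fun C f) y)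
  (fmin : R)
  (fmin_min : (exists2 y, C y & f y = fmin) /\ forall y, C y -> fmin <= f y)
  (fc : forall l, 'cV[R]_(n l) -> \bar R)
  (fc_convex : forall l, (0 < l <= LL)%N -> econvex (fc l))
  (phi : forall l, 'cV[R]_(n l) -> \bar R)
  (phi_ref : forall l, (l <= LL)%N -> reference_fun (phi l))
  (phi_ref0 : reference_on (phi 0%N) C)
  (m : nat -> nat) (m_ge1 : forall l, (0 < l <= LL)%N -> (1 <= m l)%N)
  (L tau : nat -> R) (L_gt0 : forall l, (l <= LL)%N -> 0 < L l)
  (tau_bound : forall l, (l <= LL)%N -> 0 < tau l <= (L l)^-1)
  (abar beta sigma : R) (abar_gt0 : 0 < abar)
  (beta01 : 0 < beta < 1) (sigma01 : 0 < sigma < 1)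
  (f_smooth : rel_smooth (L 0%N) (ext_fun C f) (phi 0%N) C)
  (f_step : forall t : R, 0 < t ->
     unique_bregman_step C (phi 0%N) t (ext_fun C f))
  (theta : R -> R) (theta_gt0 : forall t : R, 0 < t -> 0 < theta t)
  (eta : R) (eta_gt0 : 0 < eta)
  (phi_theta : forall y (t : R) y_t y_1, int_ C y -> 0 < t ->
     bregman_step C (phi 0%N) t (ext_fun C f) y y_t ->
     bregman_step C (phi 0%N) 1 (ext_fun C f) y y_1 ->
     ((theta t)%:E * bregman (phi 0%N) y y_1 <= bregman (phi 0%N) y y_t)%E)
  (phi_eta : forall y y_1, int_ C y ->
     bregman_step C (phi 0%N) 1 (ext_fun C f) y y_1 ->
     ((eta * (f y - fmin))%:E <= bregman (phi 0%N) y y_1)%E)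
  (crit : nat -> forall l, 'cV[R]_(n l) -> Prop)
  (x : nat -> 'cV[R]_(n 0%N)) (c : nat -> vcycle R n) (x0_int : int_ C (x 0%N))
  (x_iter : forall k, is_iteration LL Rst C f fc phi tau m abar beta sigma
     (crit k) (x k) (x k.+1) (c k))
  (phi_refc : forall k l, (0 < l <= coarsest (c k))%N ->
     reference_on (phi l) (feasible (c k) l))
  (fc_diff : forall k l, (0 < l <= coarsest (c k))%N ->
     forall y, int_ (feasible (c k) l) y -> has_gradient (fc l) y)
  (fc_smooth : forall k l, (0 < l <= coarsest (c k))%N ->
     rel_smooth (L l) (fc l) (phi l) (feasible (c k) l))
  (fc_step : forall k l, (0 < l <= coarsest (c k))%N ->
     unique_bregman_step (feasible (c k) l) (phi l) (tau l)
       (model Rst C f fc m (c k) l)) :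
  (fun k => f (x k)) @ \oo --> fmin /\
  forall k : nat,
    let r := theta (tau 0%N) * eta / tau 0%N in
    f (x k) - fmin <=
      (1 - r) ^+ k * (f (x 0%N) - fmin)
      - \sum_(0 <= t < k)
          (1 - r) ^+ (k - t) * coarse_decrease phi tau m sigma (c t).
Proof.
have S0 : bpgd_setting C (phi 0%N) (ext_fun C f) (L 0%N) (tau 0%N).
  have tau0 := tau_bound _ (leq0n LL); split=> //.
  - exact: phi_ref.
  - exact: econvex_ext_fun.
  - by move=> y /int_subset; exact: f_diff.
  - by apply: f_step; case/andP: tau0.
have /andP[tau0 _] := setting_tau S0.
have fE y : C y -> fine (ext_fun C f y) = f y.
  by move=> Cy; rewrite /ext_fun mem_set.
set r := theta (tau 0%N) * eta / tau 0%N.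
have r0 : 0 < r by rewrite divr_gt0// mulr_gt0// theta_gt0.
have step_rate y u : int_ C y ->
    bregman_step C (phi 0%N) (tau 0%N) (ext_fun C f) y u ->
    f u - fmin <= (1 - r) * (f y - fmin).
  move=> Cy hu; have Cu := step_int S0 Cy hu.
  have [y1 Cy1 [hy1 _]] := f_step _ ltr01 _ Cy.
  have fu := setting_fin_phi S0 Cu; have fy := setting_fin_phi S0 Cy.
  have fy1 := setting_fin_phi S0 Cy1.
  have := phi_theta _ _ _ _ Cy tau0 hu hy1; have := phi_eta _ _ Cy hy1.
  rewrite -(fineK (bregman_fin_num fy fy1)) -(fineK (bregman_fin_num fy fu)).
  rewrite -EFinM !lee_fin => h1 h2.
  have := step_decrease S0 Cy hu; rewrite !fE; try exact: int_subset.
  have h3 : r * (f y - fmin) <=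
      (tau 0%N)^-1 * fine (bregman (phi 0%N) y u).
    rewrite /r [_ / _]mulrC -!mulrA ler_pM2l ?invr_gt0//.
    by apply: le_trans h2; rewrite ler_pM2l// theta_gt0.
  lra.
have settings k l : int_ C (x k) -> (l <= coarsest (c k))%N ->
    bpgd_setting (feasible (c k) l) (phi l) (model Rst C f fc m (c k) l)
      (L l) (tau l).
  have [[fC _ _] [topL _ _] hr _] := x_iter k.
  case: l => [|l] xk ltop; first by rewrite fC.
  have lr : (0 < l.+1 <= coarsest (c k))%N by [].
  have lL : (0 < l.+1 <= LL)%N by rewrite (leq_trans ltop).
  have [_ [[_ Kc _ _] _]] := hr l ltop.
  (* A coarse model unfolds to a tilt of fc l.+1. *)
  apply: tilt_setting => //.
  - exact: phi_ref.
  - exact: phi_refc.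
  - exact: fc_convex.
  - exact: fc_diff.
  - exact: fc_smooth.
  - exact: fc_step.
  - exact: tau_bound.
(* The last fine step starts from a point z: the corrected point, or the
   iterate itself when no coarse correction is triggered. *)
have cycle k : int_ C (x k) ->
    0 <= coarse_decrease phi tau m sigma (c k) /\
    exists z, [/\ int_ C z,
      f z <= f (x k) - coarse_decrease phi tau m sigma (c k) &
      bregman_step C (phi 0%N) (tau 0%N) (ext_fun C f) z (x k.+1)].
  move=> xk; have [[fC xE outE] [topL _ _] hr] := x_iter k.
  have [top0 [outtop hp]|top0 hstep] := ltnP 0 (coarsest (c k)); last first.
    have -> : coarse_decrease phi tau m sigma (c k) = 0.
      by rewrite /coarse_decrease ltnNge top0.
    split=> //; exists (x k); split; rewrite ?subr0//.
    by move: hstep; rewrite /level_step fC.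
  have s0 : 0 < sigma by case/andP: sigma01.
  have hset l := settings k l xk.
  have hcv l : (0 < l <= coarsest (c k))%N -> econvex (fc l).
    by move=> /andP[l0 lt]; apply: fc_convex; rewrite l0 (leq_trans lt).
  have hst : int_ (feasible (c k) 0) (iterate (c k) 0 (m 0%N)).
    by rewrite fC xE.
  split.
    exact: (coarse_decrease_ge0 s0 hset hr hp).
  have [_ _ _ zint hstep] := hp 0%N top0.
  rewrite fC in zint; exists (corrected (c k) 0%N); split=> //.
    have := cycle_decrease s0 hset hcv (fc_diff k) hst hr (fun=> outtop) hp
      top0.
    by rewrite xE /= !fE//; exact: int_subset.
  by move: hstep; rewrite /level_step fC outE.
have xint k : int_ C (x k).
  elim: k => [|k IH]; first exact: x0_int.
  have [_ [z [zint _ hz]]] := cycle k IH.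
  exact: (step_int S0 zint hz).
have fmin_le y : int_ C y -> 0 <= f y - fmin.
  by move=> /int_subset Cy; rewrite subr_ge0; exact: fmin_min.2.
pose z k := sval (cid (cycle k (xint k)).2).
have zP k : [/\ int_ C (z k),
      f (z k) <= f (x k) - coarse_decrease phi tau m sigma (c k) &
      bregman_step C (phi 0%N) (tau 0%N) (ext_fun C f) (z k) (x k.+1)].
  by rewrite /z; case: cid.
have [|||||| lim bound] := @linear_rate R (1 - r) (fun k => f (x k) - fmin)
  (fun k => f (z k) - fmin)
  (fun k => coarse_decrease phi tau m sigma (c k)).
- by rewrite ltrBlDr ltrDl.
- by move=> k; exact: (fmin_le _ (xint k)).
- by move=> k; exact: (cycle k (xint k)).1.
- move=> k; have [zint fz _] := zP k; rewrite fmin_le//=.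
  by rewrite addrAC lerD2r.
- by move=> k; have [zint _ hz] := zP k; exact: step_rate.
(* Contraction from the iterate itself, whose fine step need not be the one
   that the algorithm takes. *)
- move=> k; have [u Cu [hu _]] := setting_step S0 (xint k).
  exact: le_trans (fmin_le _ Cu) (step_rate _ _ (xint k) hu).
split=> //.
have -> : (fun k => f (x k)) = (fun k => (f (x k) - fmin) + fmin).
  by apply/funext => k; rewrite subrK.
rewrite -[in X in _ --> X](add0r fmin).
by apply: cvgD; [exact: lim | exact: cvg_cst].
Qed.
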